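(* Let $\{G_t(x)\}_{t\ge 0}$ be the sequence of Fermat-Lucas polynomials, and let $a_1,a_2,a_3$ and $b_1,b_2,b_3$ be the vertices of a star of David with parameters $(m,n)$ in its Hosoya polynomial triangle, such that the diagonal coordinates of $a_2$ are not $(0,0)$. (1) In configuration (a): if $nm\not\equiv 0\pmod 9$ and $(n-2)(m+2)\not\equiv 0\pmod 9$, then $\gcd(a_1,a_2,a_3)=\gcd(b_1,b_2,b_3)$. (2) In configuration (b): if $nm\not\equiv 0\pmod 9$ and $(n-2)(m-2)\not\equiv 0\pmod 9$, then $\gcd(a_1,a_2,a_3)=\gcd(b_1,b_2,b_3)$.
   Context: The Fermat-Lucas polynomials are given by $G_0=2$, $G_1=3x$, $G_n=3x\,G_{n-1}-2\,G_{n-2}$ for $n\ge 2$. All gcds of polynomials are taken in $\mathbb{Z}[x]$ and equalities of gcds are up to sign. The Hosoya polynomial triangle of $\{G_t(x)\}$ is the triangular array whose $k$-th entry ($0\le k\le r$) in row $r\ge0$ is $G_k(x)G_{r-k}(x)$; the point $G_m(x)G_n(x)$ has diagonal coordinates $(m,n)$. A star of David with parameters $(m,n)$ is one of the following. Configuration (a), with $m\ge 0$, $n\ge 2$: $a_1=G_{m+1}G_{n-2}$, $a_2=G_mG_n$, $a_3=G_{m+2}G_{n-1}$, $b_1=G_mG_{n-1}$, $b_2=G_{m+2}G_{n-2}$, $b_3=G_{m+1}G_n$. Configuration (b), with $m\ge 2$, $n\ge 2$: $a_1=G_mG_{n-1}$, $a_2=G_{m-2}G_{n-2}$, $a_3=G_{m-1}G_n$,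 $b_1=G_{m-1}G_{n-2}$, $b_2=G_mG_n$, $b_3=G_{m-2}G_{n-1}$. *)

(* Defs.v *)
From mathcomp Require Import all_boot all_order all_algebra.

Set Implicit Arguments.
Unset Strict Implicit.
Unset Printing Implicit Defensive.

Import Order.TTheory GRing.Theory Num.Theory.
Local Open Scope ring_scope.

Fixpoint fermat_lucas (n : nat) : {poly int} :=
  match n with
  | 0%N => 2
  | 1%N => 3 * 'X
  | (n2.+1 as n1).+1 => 3 * 'X * fermat_lucas n1 - 2 * fermat_lucas n2
  end.

(* The k-th entry of row r; meaningful for k <= r. *)
Definition hosoya (G : nat -> {poly int}) (r k : nat) : {poly int} :=
  G k * G (r - k)%N.

(* The entry of the triangle with diagonal coordinates (c.1, c.2), i.e.
   G c.1 * G c.2. *)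
Definition hosoya_at (G : nat -> {poly int}) (c : nat * nat) : {poly int} :=
  hosoya G (c.1 + c.2) c.1.

(* A star of David is given by the diagonal coordinates of its vertices. *)
Record star := Star {
  a1 : nat * nat; a2 : nat * nat; a3 : nat * nat;
  b1 : nat * nat; b2 : nat * nat; b3 : nat * nat }.

(* Truncated subtraction is only meant to be used for 2 <= n. *)
Definition star_a (m n : nat) : star := {|
  a1 := (m + 1, n - 2)%N; a2 := (m, n); a3 := (m + 2, n - 1)%N;
  b1 := (m, n - 1)%N; b2 := (m + 2, n - 2)%N; b3 := (m + 1, n)%N |}.

(* Truncated subtraction is only meant to be used for 2 <= m and 2 <= n. *)
Definition star_b (m n : nat) : star := {|
  a1 := (m, n - 1)%N; a2 := (m - 2, n - 2)%N; a3 := (m - 1, n)%N;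
  b1 := (m - 1, n - 2)%N; b2 := (m, n); b3 := (m - 2, n - 1)%N |}.

Definition a_vertices (G : nat -> {poly int}) (S : star) : seq {poly int} :=
  [:: hosoya_at G (a1 S); hosoya_at G (a2 S); hosoya_at G (a3 S)].

Definition b_vertices (G : nat -> {poly int}) (S : star) : seq {poly int} :=
  [:: hosoya_at G (b1 S); hosoya_at G (b2 S); hosoya_at G (b3 S)].

(* Divisibility in Z[x].  The library's dvdp is not suitable: on {poly int}
   it is pseudo-divisibility, that is divisibility in Q[x]. For the same
   reason gcdp does not compute gcds in Z[x]. *)
Definition zpdvd (p q : {poly int}) : Prop := exists r, q = r * p.

Definition is_zpgcd (s : seq {poly int}) (d : {poly int}) : Prop :=
  (forall p, p \in s -> zpdvd d p) /\
  (forall e, (forall p, p \in s -> zpdvd e p) -> zpdvd e d).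

(* gcd(s) = gcd(t) up to sign.  Existence of the gcds is part of the claim;
   by is_zpgcd_uniq it does not matter which gcds are chosen. *)
Definition zpgcd_eq (s t : seq {poly int}) : Prop :=
  exists d e, [/\ is_zpgcd s d, is_zpgcd t e & d = e \/ d = - e].

Lemma is_zpgcd_uniq s d e : is_zpgcd s d -> is_zpgcd s e -> d = e \/ d = - e.
Proof.
move=> [ds dmax] [es emax].
have [u du] := dmax _ es; have [v ev] := emax _ ds.
have [e0|e0] := eqVneq e 0; first by left; rewrite du e0 mulr0.
have uv : v * u = 1.
  by apply: (mulIf e0); rewrite mul1r -mulrA -du -ev.
have Uu : u \is a GRing.unit by apply/unitrPr; exists v; rewrite mulrC.
move: Uu; rewrite poly_unitE => /andP[/size_poly1P[c _ uc]].
rewrite {}uc in du *; rewrite coefC /= => /orP[]/eqP cE.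
  by left; rewrite du cE mul1r.
by right; rewrite du cE polyCN mulN1r.
Qed.

(* Main.v *)
Require Import Defs.
From mathcomp Require Import all_boot all_order all_algebra.
From mathcomp Require Import ring.

(** Write G_k for the Fermat-Lucas polynomials.  In all four triples of
    vertices the diagonal coordinates are (r, j), (i, s), (i', j'), where i
    and i' are the two neighbours of r, and j and j' the two neighbours of s.
    The centres (r, s), which are (m + 1, n - 1) in configuration (a) and
    (m - 1, n - 1) in configuration (b), are the same for both triples of a
    star; only the choice of which neighbour is called i and which is called j
    changes.  It therefore suffices that, unless 3 divides both i and j, the
    gcd of such a triple depends on (r, s) alone: it is 3x if r and s are both
    even, and 1 otherwise ([star_gcd]).

    For the upper bound, read the recurrence
    G_(k+2) = 3x G_(k+1) - 2 G_k backwards: up to powers of 2, the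
    polynomials G_k and G_(k+1) generate the unit ideal, and G_k and G_(k+2)
    generate an ideal containing 3x.  Combining these relations, a common
    divisor e of the three products divides 2^k (3x)^2 for some k
    ([star_common_divisor]).  The only possible prime factors of e are thus
    2, 3 and x.  They are controlled by evaluating a well-chosen vertex:
    - G_k(1) = 2^k + 1 is odd for k > 0, so 2 does not divide e;
    - if k is even, G_k(0) is, up to sign, a power of 2, so neither 3 nor x
      divides a product of two polynomials of even index, and such a product
      occurs in the triple unless i and j are both odd;
    - if k is odd, G_k = 3 k (-2)^((k-1)/2) x + O(x^2), so in the remaining
      case x^2 does not divide e, and 9 does not either unless 3 divides both
      i and j.
    The congruence hypotheses modulo 9, one for each triple, exclude the
    case where 3 divides both i and j.  As 3x divides every G_k of odd
    index, 3x is then the gcd. *)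

Set Implicit Arguments.
Unset Strict Implicit.
Unset Printing Implicit Defensive.

Import GRing.Theory Num.Theory.
Local Open Scope ring_scope.

Local Notation G := fermat_lucas.

(** * Divisibility and prime elements in Z[x] *)

Lemma zpdvd_mull h p q : zpdvd p q -> zpdvd p (h * q).
Proof. by case=> r ->; exists (h * r); rewrite mulrA. Qed.

Lemma zpdvd_mulr h p q : zpdvd p q -> zpdvd p (q * h).
Proof. by rewrite mulrC; apply: zpdvd_mull. Qed.

Lemma zpdvdB p q1 q2 : zpdvd p q1 -> zpdvd p q2 -> zpdvd p (q1 - q2).
Proof. by case=> r1 -> [r2 ->]; exists (r1 - r2); rewrite mulrBl. Qed.

Lemma zpdvd_trans q p r : zpdvd p q -> zpdvd q r -> zpdvd p r.
Proof. by move=> pq [h ->]; apply: zpdvd_mull. Qed.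

Definition zpprime (p : {poly int}) : Prop :=
  p != 0 /\ forall f g, zpdvd p (f * g) -> zpdvd p f \/ zpdvd p g.

(** Cancelling a prime that does not divide the divisor replaces, for the few
    primes needed here, unique factorization in Z[x]. *)
Lemma zpdvd_coprime_prime p e g :
  zpprime p -> ~ zpdvd p e -> zpdvd e (p * g) -> zpdvd e g.
Proof.
move=> [p0 pP] pNe [f fE].
have pfe : zpdvd p (f * e) by exists g; rewrite -fE mulrC.
case: (pP _ _ pfe) => [[f' f'E]|//].
by exists f'; apply: (mulfI p0); rewrite fE f'E; ring.
Qed.

Lemma zpdvd_coprime_primeX p e k g :
  zpprime p -> ~ zpdvd p e -> zpdvd e (p ^+ k * g) -> zpdvd e g.
Proof.
move=> pP pNe; elim: k => [|k IHk]; first by rewrite mul1r.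
by rewrite exprS -mulrA => /(zpdvd_coprime_prime pP pNe).
Qed.

(** The same cancellation when e may contain p once: at most one of the two
    factors p can be absorbed by e. *)
Lemma zpdvd_prime_sq p e g :
  zpprime p -> ~ zpdvd (p ^+ 2) e -> zpdvd e (p ^+ 2 * g) -> zpdvd e (p * g).
Proof.
move=> pP ppNe; rewrite expr2 -mulrA => ed.
have [p0 pPM] := pP; case: (ed) => f fE.
have pfe : zpdvd p (f * e) by exists (p * g); rewrite -fE mulrC.
case: (pPM _ _ pfe) => [[f' f'E]|[e' e'E]].
  by exists f'; apply: (mulfI p0); rewrite fE f'E; ring.
have ed' : zpdvd e' (p * g).
  by exists f; apply: (mulfI p0); rewrite fE e'E; ring.
have pNe' : ~ zpdvd p e'.
  by case=> h hE; apply: ppNe; exists h; rewrite e'E hE; ring.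
have [h hE] := zpdvd_coprime_prime pP pNe' ed'.
by exists h; rewrite e'E hE; ring.
Qed.

(** This turns divisibility by a constant into divisibility of an integer, the
    content, so that Gauss's lemma makes prime numbers prime in Z[x]. *)
Lemma zpdvd_nat (c : nat) (f : {poly int}) :
  zpdvd c%:R f <-> (c %| zcontents f)%Z.
Proof.
have cE : c%:R = (c%:Z)%:P :> {poly int} by rewrite -polyC_natr natz.
rewrite dvdz_contents /zpdvd cE; split=> [[r ->]|/polyOver_dvdzP[r ->]].
  by apply/polyOver_dvdzP; exists r; rewrite mulrC mul_polyC.
by exists r; rewrite mulrC mul_polyC.
Qed.

Lemma zpprime_nat (c : nat) : prime c -> zpprime c%:R.
Proof.
move=> pc; split=> [|f g].
  by rewrite -polyC_natr polyC_eq0 pnatr_eq0 -lt0n prime_gt0.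
rewrite !zpdvd_nat zcontentsM !dvdzE abszM /= Euclid_dvdM //.
by case/orP; [left | right].
Qed.

Lemma zpdvdX f : zpdvd 'X f <-> f`_0 = 0.
Proof.
rewrite -horner_coef0; split=> [[r ->]|/eqP/factor_theorem[r ->]].
  by rewrite hornerM hornerX mulr0.
by exists r; rewrite subr0.
Qed.

Lemma zpprimeX : zpprime 'X.
Proof.
split=> [|f g]; first by rewrite polyX_eq0.
rewrite !zpdvdX coef0M => /eqP; rewrite mulf_eq0.
by case/orP => /eqP; [left | right].
Qed.

Lemma is_zpgcd_eq_mem s t d : s =i t -> is_zpgcd s d -> is_zpgcd t d.
Proof.
move=> st [sd dmax]; split=> [p|e te]; first by rewrite -st; apply: sd.
by apply: dmax => p; rewrite st; apply: te.
Qed.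

(** * Divisibility up to powers of two *)

(** Divisibility of f by e in Z[1/2][x], expressed without localizing; the
    backward recurrence for the Fermat-Lucas polynomials divides by 2. *)
Definition zpdvd2 (e f : {poly int}) : Prop := exists k, zpdvd e (2 ^+ k * f).

Lemma zpdvd2W e f : zpdvd e f -> zpdvd2 e f.
Proof. by exists 0%N; rewrite mul1r. Qed.

Lemma zpdvd2_mull h e f : zpdvd2 e f -> zpdvd2 e (h * f).
Proof. by case=> k ef; exists k; rewrite mulrCA; apply: zpdvd_mull. Qed.

Lemma zpdvd2_mulr h e f : zpdvd2 e f -> zpdvd2 e (f * h).
Proof. by rewrite mulrC; apply: zpdvd2_mull. Qed.

Lemma zpdvd2B e f g : zpdvd2 e f -> zpdvd2 e g -> zpdvd2 e (f - g).
Proof.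
case=> k ef [l eg]; exists (k + l)%N.
have -> : 2 ^+ (k + l) * (f - g) =
          2 ^+ l * (2 ^+ k * f) - 2 ^+ k * (2 ^+ l * g) by rewrite exprD; ring.
by apply: zpdvdB; apply: zpdvd_mull.
Qed.

Lemma zpdvd2_double e f : zpdvd2 e (2 * f) -> zpdvd2 e f.
Proof. by case=> k ef; exists k.+1; rewrite exprSr -mulrA. Qed.

(** * Fermat-Lucas polynomials *)

Lemma fermat_lucasSS k : G k.+2 = 3 * 'X * G k.+1 - 2 * G k.
Proof. by []. Qed.

(** Consecutive terms are comaximal up to powers of 2: descend along
    2 G_k = 3x G_(k+1) - G_(k+2) until G_0 = 2 is reached.  The factor h makes
    the statement usable as a cancellation rule. *)
Lemma zpdvd2_fermat_lucas_succ e h k :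
  zpdvd2 e (h * G k) -> zpdvd2 e (h * G k.+1) -> zpdvd2 e h.
Proof.
elim: k => [|k IHk] ek ek1.
  by apply: zpdvd2_double; rewrite mulrC.
apply: (IHk) (ek); apply: zpdvd2_double.
have -> : 2 * (h * G k) = 3 * 'X * (h * G k.+1) - h * G k.+2.
  by rewrite fermat_lucasSS; ring.
by apply: zpdvd2B => //; apply: zpdvd2_mull.
Qed.

(** The recurrence puts 3x G_(k+1) in the ideal of G_k and G_(k+2), and
    G_(k+1) is comaximal with G_k up to powers of 2. *)
Lemma zpdvd2_fermat_lucas_add2 e h k :
  zpdvd2 e (h * G k) -> zpdvd2 e (h * G k.+2) -> zpdvd2 e (3 * 'X * h).
Proof.
move=> ek ek2; apply: (zpdvd2_fermat_lucas_succ (k := k)).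
  by rewrite -mulrA; apply: zpdvd2_mull.
have -> : 3 * 'X * h * G k.+1 = h * G k.+2 - (- 2) * (h * G k).
  by rewrite fermat_lucasSS; ring.
by apply: zpdvd2B => //; apply: zpdvd2_mull.
Qed.

Lemma fermat_lucas_at1 k : (G k).[1] = 2 ^+ k + 1.
Proof.
elim/ltn_ind: k => -[|[|k]] IH.
- by rewrite /= -polyC_natr hornerC.
- by rewrite /= -polyC_natr hornerCM hornerX.
by rewrite fermat_lucasSS -!polyC_natr !hornerE !IH // !exprS; ring.
Qed.

(** Both parities have to be treated together, because the coefficient of x at
    an odd index involves the constant coefficient at the preceding even
    index. *)
Lemma fermat_lucas_low k :
  [/\ (G k.*2)`_0 = 2 * (- 2) ^+ k, (G k.*2)`_1 = 0,
      (G k.*2.+1)`_0 = 0 & (G k.*2.+1)`_1 = 3 * (k.*2.+1)%:R * (- 2) ^+ k].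
Proof.
have rec0 n : (G n.+2)`_0 = - 2 * (G n)`_0.
  by rewrite fermat_lucasSS -!polyC_natr -mulrA coefB !coefCM coefXM /=; ring.
have rec1 n : (G n.+2)`_1 = 3 * (G n.+1)`_0 - 2 * (G n)`_1.
  by rewrite fermat_lucasSS -!polyC_natr -mulrA coefB !coefCM coefXM.
elim: k => [|k [e0 e1 o0 o1]].
  by split; rewrite /= -?polyC_natr ?coefCM ?coefC ?coefX.
have eE0 : (G k.+1.*2)`_0 = 2 * (- 2) ^+ k.+1.
  by rewrite doubleS rec0 e0 exprS; ring.
split=> //; rewrite doubleS.
- by rewrite rec1 o0 e1; ring.
- by rewrite rec0 o0 mulr0.
have kE : k.*2.+3%:R = k.*2.+1%:R + 2 :> int by rewrite -addn2 natrD.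
by rewrite rec1 -doubleS eE0 o1 kE !exprS; ring.
Qed.

Lemma fermat_lucas_coef0_even k : ~~ odd k -> (G k)`_0 = 2 * (- 2) ^+ k./2.
Proof.
by move=> /even_halfK kE; have [+ _ _ _] := fermat_lucas_low k./2; rewrite kE.
Qed.

Lemma fermat_lucas_coef0_odd k : odd k -> (G k)`_0 = 0.
Proof.
move=> k_odd; have [_ _ + _] := fermat_lucas_low k./2.
by rewrite odd_halfK // prednK // odd_gt0.
Qed.

Lemma fermat_lucas_coef1_odd k :
  odd k -> (G k)`_1 = 3 * k%:R * (- 2) ^+ k./2.
Proof.
move=> k_odd; have [_ _ _] := fermat_lucas_low k./2.
by rewrite odd_halfK // prednK // odd_gt0.
Qed.

Lemma zpdvd_fermat_lucas_odd k : odd k -> zpdvd (3 * 'X) (G k).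
Proof.
elim/ltn_ind: k => -[|[|k]] IH //=; first by exists 1; rewrite mul1r.
rewrite negbK => k_odd; apply: zpdvdB; last exact/zpdvd_mull/IH.
by exists (G k.+1); rewrite mulrC.
Qed.

Lemma coef1M_coef0 (f g : {poly int}) : f`_0 = 0 -> (f * g)`_1 = f`_1 * g`_0.
Proof.
by move=> f0; rewrite coefM !big_ord_recl big_ord0 /= f0 mul0r add0r addr0.
Qed.

(** The factor G_i contributes no constant term, so this coefficient is the
    first one of the product that can be nonzero. *)
Lemma fermat_lucas_oddM_coef1 i s : odd i -> ~~ odd s ->
  (G i * G s)`_1 = 3 * i%:R * 2 * (- 2) ^+ (i./2 + s./2).
Proof.
move=> i_odd s_even; rewrite coef1M_coef0; last exact: fermat_lucas_coef0_odd.
by rewrite fermat_lucas_coef1_odd // fermat_lucas_coef0_even // exprD; ring.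
Qed.

Lemma zpdvd_9_fermat_lucasM i s :
  odd i -> ~~ odd s -> zpdvd (3 ^+ 2) (G i * G s) -> (3 %| i)%N.
Proof.
move=> i_odd s_even [h /(congr1 (fun f : {poly int} => f`_1))].
rewrite fermat_lucas_oddM_coef1 // -natrX -polyC_natr coefMC => eq1.
have : (3 %| i%:R * 2 * (- 2) ^+ (i./2 + s./2))%Z.
  apply/dvdzP; exists (h`_1); apply: (@mulfI _ 3) => //.
  by rewrite !mulrA eq1 natrX; ring.
rewrite dvdzE !abszM abszX (natz i) !Euclid_dvdM ?Euclid_dvdX //=.
by rewrite !orbF.
Qed.

Lemma zpdvd_X2_fermat_lucasM i s :
  odd i -> ~~ odd s -> ~ zpdvd ('X ^+ 2) (G i * G s).
Proof.
move=> i_odd s_even [h /(congr1 (fun f : {poly int} => f`_1))].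
rewrite fermat_lucas_oddM_coef1 // coefMXn /= => /eqP.
by rewrite !mulf_eq0 expf_eq0 andbF (pnatr_eq0 _ i); case: i i_odd.
Qed.

Lemma zpdvd_X_fermat_lucasM i s :
  ~~ odd i -> ~~ odd s -> ~ zpdvd 'X (G i * G s).
Proof.
move=> i_even s_even; rewrite zpdvdX coef0M !fermat_lucas_coef0_even //.
by move/eqP; rewrite !mulf_eq0 !expf_eq0 !andbF.
Qed.

Lemma zpdvd_3_fermat_lucasM i s :
  ~~ odd i -> ~~ odd s -> ~ zpdvd 3 (G i * G s).
Proof.
move=> i_even s_even [h /(congr1 (fun f : {poly int} => f`_0))].
rewrite -polyC_natr coefMC coef0M !fermat_lucas_coef0_even // => eq0.
have : (3 %| 2 * (- 2) ^+ i./2 * (2 * (- 2) ^+ s./2))%Z.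
  by rewrite eq0 dvdz_mull.
by rewrite dvdzE !abszM !abszX !Euclid_dvdM ?Euclid_dvdX.
Qed.

Lemma zpdvd_2_fermat_lucasM i s :
  (0 < i)%N -> (0 < s)%N -> ~ zpdvd 2 (G i * G s).
Proof.
move=> i0 s0 [h /(congr1 (horner^~ 1))].
rewrite -polyC_natr !hornerM hornerC !fermat_lucas_at1.
case: i s i0 s0 => [|i] [|s] // _ _; rewrite !exprS => eq1.
have : (2 %| (1 : int))%Z.
  apply/dvdzP; exists (h.[1] - 2 * 2 ^+ i * 2 ^+ s - 2 ^+ i - 2 ^+ s).
  by rewrite !mulrBl -eq1; ring.
by [].
Qed.

(** * Triples of vertices of a star of David *)

(** The two indices next to r, in either order: triples of vertices with the
    same centre differ by these orders only. *)
Definition flank (r i i' : nat) : Prop :=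
  (r = i.+1 /\ i' = i.+2) \/ (r = i'.+1 /\ i = i'.+2).

Lemma flank_sym r i i' : flank r i i' -> flank r i' i.
Proof. by case; [right | left]. Qed.

Lemma zpdvd2_flank_mid e h r i i' : flank r i i' ->
  zpdvd2 e (h * G r) -> zpdvd2 e (h * G i) -> zpdvd2 e h.
Proof.
case=> [[-> _]|[-> ->]] er ei.
  exact: zpdvd2_fermat_lucas_succ ei er.
exact: zpdvd2_fermat_lucas_succ er ei.
Qed.

Lemma zpdvd2_flank e h r i i' : flank r i i' ->
  zpdvd2 e (h * G i) -> zpdvd2 e (h * G i') -> zpdvd2 e (3 * 'X * h).
Proof.
case=> [] [_ ->] ei ei'; first exact: zpdvd2_fermat_lucas_add2 ei ei'.
exact: zpdvd2_fermat_lucas_add2 ei' ei.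
Qed.

(** Multiplying two of the three products by suitable factors makes them share
    a cofactor, from which cancelling two neighbouring terms leaves e dividing
    G_i and G_j, as everything below, up to powers of 2.  The third product
    then gives 3x G_j' and finally (3x)^2, one factor 3x for each pair of
    indices at distance 2. *)
Lemma star_common_divisor e r i i' s j j' : flank r i i' -> flank s j j' ->
  zpdvd e (G r * G j) -> zpdvd e (G i * G s) -> zpdvd e (G i' * G j') ->
  zpdvd2 e ((3 * 'X) ^+ 2).
Proof.
move=> Fi Fj /zpdvd2W erj /zpdvd2W eis /zpdvd2W eij'.
(* The configuration is symmetric under exchanging the two coordinates, so
   one argument serves for both G_i and G_j. *)
have half u v v' w w' u' : flank u v v' -> flank w w' u' ->
  zpdvd2 e (G u * G w') -> zpdvd2 e (G v * G w) -> zpdvd2 e (G v' * G u') ->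
  zpdvd2 e (G v).
  move=> Fv Fw e1 e2 e3.
  apply: (zpdvd2_flank_mid (flank_sym Fv)).
    apply: (zpdvd2_flank_mid Fw).
      by rewrite mulrAC; apply: zpdvd2_mulr.
    by rewrite -mulrA; apply: zpdvd2_mull.
  apply: (zpdvd2_flank_mid (flank_sym Fw)).
    by rewrite mulrAC; apply: zpdvd2_mulr.
  by rewrite -mulrA; apply: zpdvd2_mull.
have ei : zpdvd2 e (G i) by apply: half Fi Fj erj eis eij'.
have ej : zpdvd2 e (G j).
  by apply: half Fj Fi _ _ _; rewrite mulrC.
have ej' : zpdvd2 e (3 * 'X * G j').
  apply: (zpdvd2_flank Fi); first exact: zpdvd2_mull.
  by rewrite mulrC.
rewrite expr2; apply: (zpdvd2_flank Fj) => //.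
exact: zpdvd2_mull.
Qed.

Definition star_zpgcd (r s : nat) : {poly int} :=
  if ~~ odd r && ~~ odd s then 3 * 'X else 1.

(** The answer does not depend on which neighbours are called i and j, and this
    is why the two triples of a star have the same gcd. *)
Lemma star_gcd r i i' s j j' : flank r i i' -> flank s j j' ->
  ~~ ((3 %| i) && (3 %| j))%N ->
  is_zpgcd [:: G r * G j; G i * G s; G i' * G j']
           (star_zpgcd r s).
Proof.
move=> Fi Fj N9.
have r_odd : odd r = ~~ odd i by case: Fi => [[-> _]|[-> ->]] /=; rewrite ?negbK.
have i'_odd : odd i' = odd i by case: Fi => [[_ ->]|[_ ->]] /=; rewrite ?negbK.
have s_odd : odd s = ~~ odd j by case: Fj => [[-> _]|[-> ->]] /=; rewrite ?negbK.
have j'_odd : odd j' = odd j by case: Fj => [[_ ->]|[_ ->]] /=; rewrite ?negbK.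
have r0 : (0 < r)%N by case: Fi => [] [->].
have s0 : (0 < s)%N by case: Fj => [] [->].
rewrite /star_zpgcd r_odd s_odd !negbK.
split=> [p|e ed].
  have [/andP[i_odd j_odd]|_] := ifP; last by exists p; rewrite mulr1.
  rewrite !inE => /or3P[]/eqP ->;
    [apply: zpdvd_mull|apply: zpdvd_mulr|apply: zpdvd_mulr];
    by apply: zpdvd_fermat_lucas_odd; rewrite ?i'_odd.
have erj : zpdvd e (G r * G j) by apply: ed; rewrite inE eqxx.
have eis : zpdvd e (G i * G s) by apply: ed; rewrite !inE eqxx orbT.
have eij : zpdvd e (G i' * G j') by apply: ed; rewrite !inE eqxx !orbT.
(* G_0 = 2 is harmless: i and j are not both 0, since 3 divides 0. *)
have N2 : ~ zpdvd 2 e.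
  move=> e2; have [i0|i0] := posnP i; last first.
    exact: zpdvd_2_fermat_lucasM i0 s0 (zpdvd_trans e2 eis).
  have [j0|j0] := posnP j; first by rewrite i0 j0 in N9.
  exact: zpdvd_2_fermat_lucasM r0 j0 (zpdvd_trans e2 erj).
have [k] := star_common_divisor Fi Fj erj eis eij.
move=> /(zpdvd_coprime_primeX (zpprime_nat (isT : prime 2)) N2).
have P3 := zpprime_nat (isT : prime 3).
have [/andP[i_odd j_odd]|evenP] := ifP.
  (* The vertex with coordinates (i, s) or (r, j), according to which of i
     and j is not a multiple of 3. *)
  have N3 : ~ zpdvd (3 ^+ 2) e.
    move=> e9; case/negP: N9; apply/andP; split.
      apply: (zpdvd_9_fermat_lucasM i_odd) (zpdvd_trans e9 eis).
      by rewrite s_odd negbK.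
    apply: (zpdvd_9_fermat_lucasM (s := r) j_odd).
      by rewrite r_odd negbK.
    by rewrite mulrC; apply: zpdvd_trans erj.
  have NX : ~ zpdvd ('X ^+ 2) e.
    move=> eX; apply: (zpdvd_X2_fermat_lucasM i_odd) (zpdvd_trans eX eis).
    by rewrite s_odd negbK.
  rewrite exprMn => /(zpdvd_prime_sq P3 N3); rewrite mulrC.
  by move=> /(zpdvd_prime_sq zpprimeX NX); rewrite mulrC.
have [N3 NX] : ~ zpdvd 3 e /\ ~ zpdvd 'X e.
  have some u v : ~~ odd u -> ~~ odd v -> zpdvd e (G u * G v) ->
      ~ zpdvd 3 e /\ ~ zpdvd 'X e.
    move=> u_even v_even euv; split=> ep; have epuv := zpdvd_trans ep euv.
      exact: zpdvd_3_fermat_lucasM epuv.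
    exact: zpdvd_X_fermat_lucasM epuv.
  (* Each of the three parity patterns makes the coordinates of one vertex
     both even. *)
  case: (boolP (odd i)) => i_odd; case: (boolP (odd j)) => j_odd.
  - by rewrite i_odd j_odd in evenP.
  - by apply: some erj; rewrite ?r_odd ?i_odd.
  - by apply: some eis; rewrite ?s_odd ?j_odd.
  - by apply: some eij; rewrite ?i'_odd ?j'_odd.
rewrite exprMn => /(zpdvd_coprime_primeX P3 N3).
by rewrite -[X in zpdvd _ X]mulr1 => /(zpdvd_coprime_primeX zpprimeX NX).
Qed.

Lemma hosoya_atE i j : hosoya_at G (i, j) = G i * G j.
Proof. by rewrite /hosoya_at /hosoya /= addKn. Qed.


Lemma not_both_dvd3 i j :
  (j * i != 0 %[mod 9])%N -> ~~ ((3 %| i) && (3 %| j))%N.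
Proof.
apply: contra => /andP[i3 j3]; rewrite mod0n.
exact: (dvdn_mul j3 i3).
Qed.

Local Close Scope ring_scope.

Theorem corollary8 :
  (forall m n : nat, (2 <= n)%N ->
     a2 (star_a m n) <> (0%N, 0%N) ->
     n * m != 0 %[mod 9] ->
     (n - 2) * (m + 2) != 0 %[mod 9] ->
     zpgcd_eq (a_vertices fermat_lucas (star_a m n))
              (b_vertices fermat_lucas (star_a m n))) /\
  (forall m n : nat, (2 <= m)%N -> (2 <= n)%N ->
     a2 (star_b m n) <> (0%N, 0%N) ->
     n * m != 0 %[mod 9] ->
     (n - 2) * (m - 2) != 0 %[mod 9] ->
     zpgcd_eq (a_vertices fermat_lucas (star_b m n))
              (b_vertices fermat_lucas (star_b m n))).
Proof.
have up k : flank k.+1 k k.+2 by left.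
have down k : flank k.+1 k.+2 k by right.
split=> [m [|[|n]] // _ _|[|[|m]] [|[|n]] // _ _ _];
  rewrite ?subn2 ?addn2 => /not_both_dvd3 Nmn /not_both_dvd3 Nmn2;
  exists (star_zpgcd m.+1 n.+1), (star_zpgcd m.+1 n.+1);
  (split; last by left);
  rewrite /a_vertices /b_vertices /= !hosoya_atE;
  rewrite ?subSS ?subn0 ?addn1 ?addn2.
- apply: is_zpgcd_eq_mem (star_gcd (down m) (up n) Nmn2) => p.
  by rewrite !inE; do 3!case: eqP.
- apply: is_zpgcd_eq_mem (star_gcd (up m) (down n) Nmn) => p.
  by rewrite !inE; do 3!case: eqP.
- apply: is_zpgcd_eq_mem (star_gcd (down m) (down n) Nmn) => p.
  by rewrite !inE; do 3!case: eqP.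
- apply: is_zpgcd_eq_mem (star_gcd (up m) (up n) Nmn2) => p.
  by rewrite !inE; do 3!case: eqP.
Qed.
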